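(* Let $(A,[\cdot,\cdot])$ be a left-Alia algebra and let $r=\sum_i u_i\otimes v_i\in A\otimes A$ be antisymmetric (i.e. $r+\tau(r)=0$). Let $\delta_r:A\to A\otimes A$ be given by $$\delta_r(x)=\big((\mathcal R-\mathcal L)(x)\otimes\mathrm{id}-\mathrm{id}\otimes\mathcal R(x)\big)r,\qquad\forall x\in A.$$ Then the following statements are equivalent: (a) $r$ is a solution of the left-Alia Yang-Baxter equation in $(A,[\cdot,\cdot])$ (i.e. $\mathrm{Al}(r)=0$) such that $(A,[\cdot,\cdot],\delta_r)$ is a triangular left-Alia bialgebra. (b) $r^\sharp:A^*\to A$ is a relative Rota-Baxter operator of $(A,[\cdot,\cdot])$ associated to the coadjoint representation $(\mathcal L^*,\mathcal L^*-\mathcal R^*,A^* )$, that is, $$[r^\sharp(a^* ),r^\sharp(b^* )]=r^\sharp\Big(\mathcal L^*\big(r^\sharp(a^* )\big)b^*+(\mathcal L^*-\mathcal R^* )\big(r^\sharp(b^* )\big)a^*\Big),\qquad\forall a^*,b^*\in A^*.$$ In this case, $r^\sharp:(A^*,[\cdot,\cdot]_{A^*})\to(A,[\cdot,\cdot])$ is a homomorphism of left-Alia algebras, where $[\cdot,\cdot]_{A^*}:A^*\otimes A^*\to A^*$ is the linear dual of $\delta_r$.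
   Context: All vector spaces are finite-dimensional over an algebraically closed field $\mathbb K$ of characteristic zero. A left-Alia algebra is a vector space $A$ with a bilinear map $[\cdot,\cdot]:A\times A\to A$ (not assumed antisymmetric) such that for all $x,y,z\in A$ $$[[x,y],z]+[[y,z],x]+[[z,x],y]=[[y,x],z]+[[z,y],x]+[[x,z],y].$$ $\mathcal L,\mathcal R:A\to\mathrm{End}(A)$ are given by $\mathcal L(x)y=[x,y]=\mathcal R(y)x$. For a linear map $l:A\to\mathrm{End}(V)$, $l^*:A\to\mathrm{End}(V^* )$ is defined by $\langle l^*(x)u^*,v\rangle=-\langle u^*,l(x)v\rangle$. Let $\tau(x\otimes y)=y\otimes x$ and $\xi(x\otimes y\otimes z)=y\otimes z\otimes x$. For $r=\sum_i u_i\otimes v_i\in A\otimes A$, $$\mathrm{Al}(r)=\sum_{i,j}\Big([u_i,u_j]\otimes v_i\otimes v_j+u_i\otimes([u_j,v_i]-[v_i,u_j])\otimes v_j-u_i\otimes u_j\otimes[v_j,v_i]\Big)\in A^{\otimes 3},$$ and $r^\sharp:A^*\to A$ is defined by $\langle r^\sharp(a^* ),b^*\rangle=\langle r,a^*\otimes b^*\rangle$ for $a^*,b^*\in A^*$. The linear dual of $\delta_r$ is defined by $\langle[a^*,b^*]_{A^*},x\rangle=\langle a^*\otimes b^*,\delta_r(x)\rangle$. A left-Alia coalgebra is a pair $(A,\delta)$ with $\delta:A\to A\otimes A$ linear such that $(\mathrm{id}^{\otimes3}+\xi+\xi^2)(\tau\otimes\mathrm{id}-\mathrm{id}^{\otimes3})(\delta\otimes\mathrm{id})\delta=0$.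 A left-Alia bialgebra is a triple $(A,[\cdot,\cdot],\delta)$ such that $(A,[\cdot,\cdot])$ is a left-Alia algebra, $(A,\delta)$ is a left-Alia coalgebra and, for all $x,y\in A$, $$(\tau-\mathrm{id}^{\otimes 2})\Big(\delta([x,y]-[y,x])+(\mathcal R(x)\otimes\mathrm{id})\delta(y)-(\mathcal R(y)\otimes\mathrm{id})\delta(x)\Big)=0.$$ A left-Alia bialgebra is called triangular if it is of the form $(A,[\cdot,\cdot],\delta_r)$ with $r$ satisfying $r+\tau(r)=0$ and $\mathrm{Al}(r)=0$ (such triples are always left-Alia bialgebras). *)

(* Defs.v *)
From HB Require Import structures.
From mathcomp Require Import all_boot all_algebra.

Set Implicit Arguments.
Unset Strict Implicit.
Unset Printing Implicit Defensive.

Import GRing.Theory.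
Local Open Scope ring_scope.

Notation dual V := 'Hom(V, _^o) (only parsing).

(** ** Tensor product of finite-dimensional spaces

   An element of [tensor U V] is stored as its matrix of coordinates on the
   [e_i (x) e'_j], where [e], [e'] are the [vbasis] of [U], [V].
   [tensor_span] and [tliftE] are the universal property, and every map below
   is specified on pure tensors, so the choice of bases is immaterial. *)

Section Tensor.
Variable K : fieldType.

Definition tensor (U V : vectType K) : Type := 'M[K]_(\dim {:U}, \dim {:V}).
HB.instance Definition _ (U V : vectType K) :=
  Vector.copy (tensor U V) 'M[K]_(\dim {:U}, \dim {:V}).

Definition pure (U V : vectType K) (u : U) (v : V) : tensor U V :=
  \matrix_(i, j) (coord (vbasis {:U}) i u * coord (vbasis {:V}) j v).

Definition tlift (U V W : vectType K) (f : U -> V -> W) (t : tensor U V) : W :=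
  \sum_i \sum_j
    (t : 'M_(_, _)) i j *: f (vbasis {:U})`_i (vbasis {:V})`_j.

End Tensor.

Notation "x ⊗ y" := (pure x y) (at level 40, left associativity) : ring_scope.

Section TensorTheory.
Variable K : fieldType.
Implicit Types U V W : vectType K.

Notation bilin f := (bilinear_for *:%R *:%R f).

Lemma pure_bilinear U V : bilin (@pure K U V).
Proof.
split=> w a x y; apply/matrixP=> i j; rewrite /pure !mxE linearP.
  by rewrite mulrDl mulrA.
by rewrite mulrDr mulrCA.
Qed.

Lemma tlift_is_linear U V W (f : U -> V -> W) : linear (tlift f).
Proof.
move=> a s t; rewrite /tlift scaler_sumr -big_split; apply: eq_bigr => i _ /=.
rewrite scaler_sumr -big_split; apply: eq_bigr => j _ /=.
by rewrite !mxE scalerDl scalerA.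
Qed.

HB.instance Definition _ U V W (f : U -> V -> W) :=
  GRing.isLinear.Build K (tensor U V) W _ (tlift f) (tlift_is_linear f).

Lemma linfunE V W (g : V -> W) : linear g -> linfun g =1 g.
Proof.
move=> g_lin; pose gl : {linear V -> W} :=
  HB.pack g (GRing.isLinear.Build K V W _ g g_lin).
exact: (lfunE gl).
Qed.

Lemma linear_coord V W (g : V -> W) (v : V) : linear g ->
  g v = \sum_i coord (vbasis {:V}) i v *: g (vbasis {:V})`_i.
Proof.
move=> g_lin; pose gl : {linear V -> W} :=
  HB.pack g (GRing.isLinear.Build K V W _ g g_lin).
rewrite -[LHS]/(gl v) [in LHS](coord_vbasis (memvf v)) linear_sum.
by apply: eq_bigr => i _; rewrite linearZ.
Qed.

Lemma tliftE U V W (f : U -> V -> W) u v : bilin f -> tlift f (u ⊗ v) = f u v.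
Proof.
case=> fl fr; rewrite (linear_coord u (fl v)); apply: eq_bigr => i _.
rewrite (linear_coord v (fr _)) scaler_sumr; apply: eq_bigr => j _.
by rewrite mxE scalerA.
Qed.

Lemma tensor_span U V (t : tensor U V) : t = tlift (@pure K U V) t.
Proof.
rewrite [LHS](matrix_sum_delta (t : 'M_(_, _))) /tlift.
apply: eq_bigr => i _; apply: eq_bigr => j _; congr (_ *: _).
apply/matrixP=> k l; rewrite !mxE !coord_free ?(basis_free (vbasisP _)) // -natrM mulnb.
by rewrite (eq_sym k) (eq_sym l).
Qed.

End TensorTheory.

Section TensorMaps.
Variable K : fieldType.
Implicit Types U V W : vectType K.

Definition tmap U V U' V' (f : U -> U') (g : V -> V') :
  tensor U V -> tensor U' V' := tlift (fun u v => f u ⊗ g v).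

Definition tswap U V : tensor U V -> tensor V U := tlift (fun u v => v ⊗ u).

Definition trot V : tensor (tensor V V) V -> tensor (tensor V V) V :=
  tlift (fun xy z => tlift (fun x y => y ⊗ z ⊗ x) xy).

(* The pairing of [a (x) b] with an element of [tensor U V]. *)
Definition tpair U V (a : dual U) (b : dual V) (t : tensor U V) : K^o :=
  tlift (fun u v => (a u * b v : K^o)) t.

Notation bilin f := (bilinear_for *:%R *:%R f).

Lemma bilin_comp U V U' V' W (h : U' -> V' -> W)
    (f : U -> U') (g : V -> V') : bilin h -> linear f -> linear g ->
  bilin (fun u v => h (f u) (g v)).
Proof.
move=> [hl hr] fl gl; split=> w a x y.
  by rewrite fl hl.
by rewrite gl hr.
Qed.

Lemma bilin_swap U V W (h : U -> V -> W) : bilin h -> bilin (fun v u => h u v).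
Proof. by case. Qed.

Lemma tmapE U V U' V' (f : U -> U') (g : V -> V') u v :
  linear f -> linear g -> tmap f g (u ⊗ v) = f u ⊗ g v.
Proof.
by move=> fl gl; rewrite /tmap tliftE//; apply: bilin_comp => //; exact: pure_bilinear.
Qed.

Lemma tswapE U V (u : U) (v : V) : tswap (u ⊗ v) = v ⊗ u.
Proof. by rewrite /tswap tliftE//; apply: bilin_swap; exact: pure_bilinear. Qed.

Lemma eq_tlift U V W (f g : U -> V -> W) : f =2 g -> tlift f =1 tlift g.
Proof. by move=> fg t; apply: eq_bigr => i _; apply: eq_bigr => j _; rewrite fg. Qed.

Lemma tlift_comb U V W (f g : U -> V -> W) a t :
  tlift (fun u v => a *: f u v + g u v) t = a *: tlift f t + tlift g t.
Proof.
rewrite /tlift scaler_sumr -big_split; apply: eq_bigr => i _ /=.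
rewrite scaler_sumr -big_split; apply: eq_bigr => j _ /=.
by rewrite scalerDr !scalerA mulrC.
Qed.

Lemma trotE V (x y z : V) : trot (x ⊗ y ⊗ z) = y ⊗ z ⊗ x.
Proof.
have pl X Y := (@pure_bilinear K X Y).1; have pr X Y := (@pure_bilinear K X Y).2.
rewrite /trot tliftE; first rewrite tliftE//.
- split=> w a u v; first by rewrite pr.
  by rewrite pl pl.
- split=> w a u v; first exact: linearP.
  rewrite -tlift_comb; apply: eq_tlift => s t.
  by rewrite pr pl.
Qed.

Lemma tpairE U V (a : dual U) (b : dual V) u v : tpair a b (u ⊗ v) = a u * b v.
Proof.
rewrite /tpair tliftE//; split=> w c x y; rewrite linearP.
  by rewrite mulrDl; congr (_ + _); exact: esym (mulrA _ _ _).
by rewrite mulrDr; congr (_ + _); exact: mulrCA.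
Qed.

(* [r^#], characterised by [rsharpP]. *)
Definition rsharp V (r : tensor V V) : 'Hom(dual V, V) :=
  linfun (fun a : dual V => tlift (fun u v => a u *: v) r).

Lemma rsharpE V (r : tensor V V) (a : dual V) :
  rsharp r a = tlift (fun u v => a u *: v) r.
Proof.
have l : linear (fun a : dual V => tlift (fun u v => a u *: v) r).
  move=> c x y; rewrite -tlift_comb; apply: eq_tlift => u v.
  by rewrite add_lfunE scale_lfunE scalerDl scalerA.
exact: linfunE.
Qed.

Lemma rsharpP V (r : tensor V V) (a b : dual V) :
  b (rsharp r a) = tpair a b r.
Proof.
rewrite rsharpE /tpair /tlift linear_sum; apply: eq_bigr => i _.
rewrite linear_sum; apply: eq_bigr => j _; rewrite !linearZ.
exact: mulrCA.
Qed.

End TensorMaps.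

(** ** Left-Alia algebras *)

Section LeftAlia.
Variable K : fieldType.

Definition is_left_alia_algebra (A : vectType K) (br : {bilinear A -> A -> A}) :=
  forall x y z : A,
    br (br x y) z + br (br y z) x + br (br z x) y
    = br (br y x) z + br (br z y) x + br (br x z) y.

Definition is_left_alia_hom (A B : vectType K)
    (brA : {bilinear A -> A -> A}) (brB : {bilinear B -> B -> B})
    (f : 'Hom(A, B)) :=
  [/\ is_left_alia_algebra brA, is_left_alia_algebra brB
    & forall x y : A, f (brA x y) = brB (f x) (f y)].

Section Algebra.
Variables (A : vectType K) (br : {bilinear A -> A -> A}).

Definition Lmul (x : A) : 'End(A) := linfun (br x).
Definition Rmul (y : A) : 'End(A) := linfun (br^~ y).

Definition dual_rep (V : vectType K) (l : A -> 'End(V)) (x : A) :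
  'End(dual V) := linfun (fun u : dual V => - (u \o l x)%VF).

Definition is_rel_rota_baxter (V : vectType K) (l rho : A -> 'End(V))
    (T : 'Hom(V, A)) :=
  forall u v : V, br (T u) (T v) = T (l (T u) v + rho (T v) u).

(* With [r = \sum_i u_i (x) v_i], the outer [tlift] runs over the [i]-th and
   the inner one over the [j]-th copy of [r]: see [Al_sum]. *)
Definition Al (r : tensor A A) : tensor (tensor A A) A :=
  tlift (fun ui vi => tlift (fun uj vj =>
    br ui uj ⊗ vi ⊗ vj + ui ⊗ (br uj vi - br vi uj) ⊗ vj
    - ui ⊗ uj ⊗ br vj vi) r) r.

Definition delta_r (r : tensor A A) : 'Hom(A, tensor A A) :=
  linfun (fun x => tmap (Rmul x - Lmul x) id r - tmap id (Rmul x) r).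

Definition is_antisymmetric (r : tensor A A) := r + tswap r = 0.

Definition is_left_alia_coalgebra (delta : 'Hom(A, tensor A A)) :=
  forall x : A,
    let d := tmap delta id (delta x) in
    let t := tmap (@tswap K A A) id d - d in
    t + trot t + trot (trot t) = 0.

Definition is_left_alia_bialgebra (delta : 'Hom(A, tensor A A)) :=
  [/\ is_left_alia_algebra br, is_left_alia_coalgebra delta
    & forall x y : A,
        let t := delta (br x y - br y x) + tmap (Rmul x) id (delta y)
                 - tmap (Rmul y) id (delta x) in
        tswap t - t = 0].

Definition is_triangular_left_alia_bialgebra (delta : 'Hom(A, tensor A A)) :=
  is_left_alia_bialgebra delta /\
  exists r : tensor A A,
    [/\ is_antisymmetric r, Al r = 0 & delta = delta_r r].

End Algebra.

Definition dual_bracket (A : vectType K) (delta : 'Hom(A, tensor A A))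
    (a b : dual A) : dual A :=
  linfun (fun x : A => tpair a b (delta x)).

Lemma dual_bracketE (A : vectType K) (delta : 'Hom(A, tensor A A))
    (a b : dual A) (x : A) :
  dual_bracket delta a b x = tpair a b (delta x).
Proof.
have l : linear (fun x : A => tpair a b (delta x)).
  by move=> c u v; rewrite linearP /tpair linearP.
exact: linfunE.
Qed.

Lemma dual_bracket_bilinear (A : vectType K) (delta : 'Hom(A, tensor A A)) :
  bilinear_for *:%R *:%R (dual_bracket delta).
Proof.
split=> w c a b; apply/lfunP=> x;
  rewrite add_lfunE scale_lfunE !dual_bracketE;
  rewrite /tpair -tlift_comb; apply: eq_tlift => u v;
  rewrite add_lfunE scale_lfunE.
  by rewrite mulrDl; congr (_ + _); exact: esym (mulrA _ _ _).
by rewrite mulrDr; congr (_ + _); exact: mulrCA.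
Qed.

HB.instance Definition _ (A : vectType K) (delta : 'Hom(A, tensor A A)) :=
  bilinear_isBilinear.Build K (dual A) (dual A) (dual A) *:%R *:%R
    (dual_bracket delta) (dual_bracket_bilinear delta).

Section Facts.
Variables (A : vectType K) (br : {bilinear A -> A -> A}).

Lemma LmulE x y : Lmul br x y = br x y.
Proof. exact: lfunE. Qed.

Lemma RmulE x y : Rmul br x y = br y x.
Proof.
have l : linear (br^~ x) by move=> c u v; rewrite linearPl.
exact: linfunE.
Qed.

Lemma dual_repE (V : vectType K) (l : A -> 'End(V)) x (u : dual V) v :
  dual_rep l x u v = - u (l x v).
Proof.
have h : linear (fun u : dual V => - (u \o l x)%VF).
  move=> c a b; apply/lfunP=> w.
  by rewrite !(add_lfunE, scale_lfunE, opp_lfunE, comp_lfunE) opprD scalerN.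
by rewrite /dual_rep (linfunE h) opp_lfunE comp_lfunE.
Qed.

Lemma delta_rE r x :
  delta_r br r x = tmap (Rmul br x - Lmul br x) id r - tmap id (Rmul br x) r.
Proof.
have pl X Y := (@pure_bilinear K X Y).1; have pr X Y := (@pure_bilinear K X Y).2.
have l1 : linear (fun x => tmap (Rmul br x - Lmul br x) id r).
  move=> c y z; rewrite /tmap -tlift_comb; apply: eq_tlift => u v.
  rewrite -pl; congr (_ ⊗ _).
  rewrite !add_lfunE !opp_lfunE !RmulE !LmulE linearPr linearPl /=.
  by rewrite opprD addrACA scalerBr.
have l2 : linear (fun x => tmap id (Rmul br x) r).
  move=> c y z; rewrite /tmap -tlift_comb; apply: eq_tlift => u v.
  by rewrite -pr !RmulE linearPr.
have l : linear (fun x =>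
    tmap (Rmul br x - Lmul br x) id r - tmap id (Rmul br x) r).
  by move=> c y z; rewrite l1 l2 opprD addrACA scalerBr.
exact: linfunE.
Qed.

Lemma Al_sum n (u v : 'I_n -> A) :
  Al br (\sum_i u i ⊗ v i) =
  \sum_i \sum_j
    (br (u i) (u j) ⊗ v i ⊗ v j
     + u i ⊗ (br (u j) (v i) - br (v i) (u j)) ⊗ v j
     - u i ⊗ u j ⊗ br (v j) (v i)).
Proof.
have pl X Y := (@pure_bilinear K X Y).1; have pr X Y := (@pure_bilinear K X Y).2.
have brl c x y z : br (c *: x + y) z = c *: br x z + br y z.
  by rewrite linearPl.
have brr c x y z : br z (c *: x + y) = c *: br z x + br z y.
  by rewrite linearPr.
have brB c (a1 a2 b1 b2 : A) :
    c *: a1 + a2 - (c *: b1 + b2) = c *: (a1 - b1) + (a2 - b2).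
  by rewrite opprD addrACA scalerBr.
have comm (c : K) (T : vectType K) (a1 b1 c1 a2 b2 c2 : T) :
    c *: a1 + a2 + (c *: b1 + b2) - (c *: c1 + c2)
    = c *: (a1 + b1 - c1) + (a2 + b2 - c2).
  by rewrite scalerBr scalerDr addrACA opprD [LHS]addrACA.
rewrite /Al linear_sum; apply: eq_bigr => i _ /=; rewrite tliftE.
  rewrite linear_sum; apply: eq_bigr => j _ /=; rewrite tliftE //.
  by split=> w c x y; rewrite !(brl, brr) ?brB !(pl, pr) -comm.
by split=> w c x y; rewrite -tlift_comb; apply: eq_tlift => u' v';
  rewrite !(brl, brr) ?brB !(pl, pr) -comm.
Qed.

End Facts.
End LeftAlia.

(* Main.v *)
Require Import Defs.
From HB Require Import structures.
From mathcomp Require Import all_boot all_algebra.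
From mathcomp Require Import ring.
Import GRing.Theory.
Local Open Scope ring_scope.

(** Write [T] for [rsharp r] and [[a, b]'] for the bracket on the dual space
   that is dual to [delta_r br r].  Everything is reduced to scalar identities
   by pairing tensors with covectors.

   Antisymmetry of [r] says that [b (T a) = - a (T b)].  With it, pairing
   [delta_r br r x] with [a ⊗ b] gives (lemma [dbr_deltaE])
     [[a, b]' x = a ([x, T b] - [T b, x]) - b ([T a, x])],
   and the right-hand side is the value at [x] of the coadjoint expression
   occurring in the relative Rota-Baxter identity.  So the Rota-Baxter
   condition says exactly that [T] maps [[a, b]'] to [[T a, T b]] (lemma
   [coadRB_hom]).  Expanding [r] as a sum of pure tensors, the same kind of
   computation shows that the value of [a ⊗ b ⊗ c] on [Al br r] is
   [a ([T b, T c] - T [b, c]')] (lemma [tpair3_Al]); covectors separate points,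
   so [Al br r = 0] is the same condition again.

   It remains to see that it implies the bialgebra axioms.  The coalgebra axiom
   for a map [delta] is the left-Alia identity for the dual bracket (lemma
   [left_alia_coalgebra_dual]).  For [[., .]'], once [T] is multiplicative, the
   identity at [a], [b], [c], evaluated at [w], splits into three left-Alia
   identities of [A]: the terms in [a] are [a] applied to the identity at
   [T b], [T c], [w], and similarly for [b] and [c] (lemma [dual_left_alia]).
   The compatibility axiom holds for every antisymmetric [r]: paired with
   [a ⊗ b], the terms in which [T] is applied to [a \o R(x)] or the like are
   symmetric in [a] and [b], so [tswap - id] kills them, and what remains are
   left-Alia identities at [x], [y], [T b] and at [x], [y], [T a] (lemma
   [delta_compat]). *)

(** * Pairing tensors with covectors *)

Section TensorPairing.
Set Implicit Arguments.
Unset Strict Implicit.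
Unset Printing Implicit Defensive.

Variable K : fieldType.
Implicit Types U V W : vectType K.

HB.instance Definition _ U V :=
  bilinear_isBilinear.Build K U V (tensor U V) *:%R *:%R (@pure K U V)
    (@pure_bilinear K U V).
HB.instance Definition _ U V U' V' (f : U -> U') (g : V -> V') :=
  GRing.isLinear.Build K (tensor U V) (tensor U' V') _ (tmap f g)
    (tlift_is_linear _).
HB.instance Definition _ U V :=
  GRing.isLinear.Build K (tensor U V) (tensor V U) _ (@tswap K U V)
    (tlift_is_linear _).
HB.instance Definition _ V :=
  GRing.isLinear.Build K (tensor (tensor V V) V) (tensor (tensor V V) V) _
    (@trot K V) (tlift_is_linear _).
HB.instance Definition _ U V (a : dual U) (b : dual V) :=
  GRing.isLinear.Build K (tensor U V) K^o _ (tpair a b) (tlift_is_linear _).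

Lemma covec_eq0 V (x : V) : (forall a : dual V, a x = 0) -> x = 0.
Proof.
move=> x0; rewrite (coord_vbasis (memvf x)) big1 // => i _.
pose a : dual V := linfun (coord (vbasis {:V}) i : V -> K^o).
by have := x0 a; rewrite lfunE /= => ->; rewrite scale0r.
Qed.


Lemma tensor_sum U V (t : tensor U V) :
  exists n (u : 'I_n -> U) (v : 'I_n -> V), t = \sum_i u i ⊗ v i.
Proof.
exists (\dim {:U}), (fun i => (vbasis {:U})`_i).
exists (fun i => \sum_j (t : 'M_(_, _)) i j *: (vbasis {:V})`_j).
rewrite {1}(tensor_span t); apply: eq_bigr => i _.
by rewrite linear_sumr; apply: eq_bigr => j _; rewrite linearZr_LR.
Qed.

Lemma tensor_ext U V W (f g : {linear tensor U V -> W}) :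
  (forall u v, f (u ⊗ v) = g (u ⊗ v)) -> f =1 g.
Proof.
move=> fg t; have [n [u [v ->]]] := tensor_sum t.
by rewrite !linear_sum; apply: eq_bigr => i _; rewrite fg.
Qed.

Lemma tensor3_ext U V V' W (f g : {linear tensor (tensor U V) V' -> W}) :
  (forall u v w, f (u ⊗ v ⊗ w) = g (u ⊗ v ⊗ w)) -> f =1 g.
Proof.
move=> fg; apply: tensor_ext => t w; have [n [u [v ->]]] := tensor_sum t.
by rewrite linear_sumlz !linear_sum; apply: eq_bigr => i _; rewrite fg.
Qed.

(** The coordinates of a tensor are its pairings with products of coordinate
   forms. *)
Lemma tpair_eq0 U V (t : tensor U V) :
  (forall (a : dual U) (b : dual V), tpair a b t = 0) -> t = 0.
Proof.
move=> t0; apply/matrixP=> i j; rewrite [RHS]mxE.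
pose a : dual U := linfun (coord (vbasis {:U}) i : U -> K^o).
pose b : dual V := linfun (coord (vbasis {:V}) j : V -> K^o).
pose e (s : tensor U V) : K^o := (s : 'M_(_, _)) i j.
have e_lin : linear e by move=> c x y; rewrite /e !mxE.
pose el : {linear tensor U V -> K^o} :=
  HB.pack e (GRing.isLinear.Build K (tensor U V) K^o _ e e_lin).
rewrite -[LHS]/(el t) -(t0 a b).
apply: (@tensor_ext _ _ _ el (tpair a b)) => u v.
by rewrite /= tpairE !lfunE /= /e mxE.
Qed.

Lemma tpair_mapl U V U' (f : 'Hom(U, U')) (a : dual U') (b : dual V) t :
  tpair a b (tmap f id t) = tpair (a \o f)%VF b t.
Proof.
apply: (@tensor_ext _ _ _ (tpair a b \o tmap f id) (tpair _ _)) => u v /=.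
by rewrite tmapE ?tpairE ?comp_lfunE //; exact: linearP.
Qed.

Lemma tpair_mapr U V V' (f : 'Hom(V, V')) (a : dual U) (b : dual V') t :
  tpair a b (tmap id f t) = tpair a (b \o f)%VF t.
Proof.
apply: (@tensor_ext _ _ _ (tpair a b \o tmap id f) (tpair _ _)) => u v /=.
by rewrite tmapE ?tpairE ?comp_lfunE //; exact: linearP.
Qed.

Lemma tpair_swap U V (a : dual U) (b : dual V) (t : tensor V U) :
  tpair a b (tswap t) = tpair b a t.
Proof.
apply: (@tensor_ext _ _ _ (tpair a b \o @tswap K V U) (tpair _ _)) => u v /=.
by rewrite tswapE !tpairE mulrC.
Qed.

(** The tensor [a ⊗ b], seen as a covector on [tensor U V]: iterating it is what
   gives the pairing on triple tensors. *)
Definition dual_pure U V (a : dual U) (b : dual V) : dual (tensor U V) :=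
  linfun (tpair a b).

Definition tpair3 U V W (a : dual U) (b : dual V) (c : dual W) :=
  tpair (dual_pure a b) c.
HB.instance Definition _ U V W (a : dual U) (b : dual V) (c : dual W) :=
  GRing.Linear.copy (tpair3 a b c) (tpair (dual_pure a b) c).

Lemma tpair3E U V W (a : dual U) (b : dual V) (c : dual W) x y z :
  tpair3 a b c (x ⊗ y ⊗ z) = a x * b y * c z.
Proof. by rewrite /tpair3 tpairE lfunE /= tpairE. Qed.

Lemma tpair3_rot V (a b c : dual V) t :
  tpair3 a b c (trot t) = tpair3 c a b t.
Proof.
apply: (@tensor3_ext _ _ _ _ (tpair3 a b c \o @trot K V) (tpair3 _ _ _)).
by move=> x y z /=; rewrite trotE !tpair3E mulrC mulrA.
Qed.

Lemma tpair3_swapl V (a b c : dual V) t :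
  tpair3 a b c (tmap (@tswap K V V) id t) = tpair3 b a c t.
Proof.
apply: (@tensor3_ext _ _ _ _ (tpair3 a b c \o tmap (@tswap K V V) id)
                             (tpair3 _ _ _)).
move=> x y z /=; rewrite tmapE; [|exact: linearP|by []].
by rewrite tswapE !tpair3E (mulrC (b x)).
Qed.

(** Contracting the last factor with [c] leaves a double tensor that pairs to
   zero with all [a ⊗ b], so it vanishes, and hence so does the pairing with
   [f ⊗ c] for an arbitrary covector [f] on [tensor U V]. *)
Lemma tpair3_eq0 U V W (t : tensor (tensor U V) W) :
  (forall a b c, tpair3 a b c t = 0) -> t = 0.
Proof.
have [n [s [w ->]]] := tensor_sum t => t0.
apply: tpair_eq0 => f c.
pose q : tensor U V := \sum_i c (w i) *: s i.
have q0 : q = 0.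
  apply: tpair_eq0 => a b; rewrite -[RHS](t0 a b c) !linear_sum.
  apply: eq_bigr => i _; rewrite linearZ /= /tpair3 tpairE lfunE /=.
  exact: mulrC.
have <- : f q = 0 by rewrite q0 linear0.
rewrite !linear_sum; apply: eq_bigr => i _; rewrite /= tpairE linearZ.
exact: mulrC.
Qed.

Lemma rsharp_sum V n (u v : 'I_n -> V) (f : dual V) :
  rsharp (\sum_i u i ⊗ v i) f = \sum_i f (u i) *: v i.
Proof.
rewrite rsharpE linear_sum; apply: eq_bigr => i _; rewrite /= tliftE //.
split=> w z x y; first by rewrite linearP scalerDl [LHS]/= -scalerA.
have sc (c : K) : c *: (z *: x + y) = z *: (c *: x) + c *: y.
  by rewrite scalerDr !scalerA mulrC.
exact: sc.
Qed.


End TensorPairing.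

(** * Coalgebra structures and dual brackets *)

Section Coalgebra.
Set Implicit Arguments.
Unset Strict Implicit.
Unset Printing Implicit Defensive.

Variables (K : fieldType) (A : vectType K).

Lemma tpair3_coiter (delta : 'Hom(A, tensor A A)) (a b c : dual A) x :
  tpair3 a b c (tmap delta id (delta x)) =
  dual_bracket delta (dual_bracket delta a b) c x.
Proof.
rewrite /tpair3 tpair_mapl dual_bracketE; congr (tpair _ c _).
by apply/lfunP=> y; rewrite comp_lfunE lfunE /= dual_bracketE.
Qed.

(** Paired with [a ⊗ b ⊗ c], the coalgebra axiom becomes the left-Alia identity
   of the dual bracket, because [tswap] exchanges [a] and [b] and [trot]
   permutes the three covectors cyclically. *)
Lemma left_alia_coalgebra_dual (delta : 'Hom(A, tensor A A)) :
  is_left_alia_algebra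
    (dual_bracket delta : {bilinear dual A -> dual A -> dual A}) ->
  is_left_alia_coalgebra delta.
Proof.
move=> dP x /=; apply: tpair3_eq0 => a b c.
rewrite !(linearD, linearN) /= !tpair3_rot !tpair3_swapl !tpair3_coiter.
move/lfunP/(_ x): (dP a b c); rewrite !add_lfunE /= => dPx.
move/eqP: dPx; rewrite -subr_eq0 => /eqP dPx.
by rewrite -[RHS]oppr0 -dPx; ring.
Qed.

End Coalgebra.

(** * Antisymmetric solutions of the Yang-Baxter equation *)

Section YangBaxter.
Set Implicit Arguments.
Unset Strict Implicit.
Unset Printing Implicit Defensive.

Variables (K : fieldType) (A : vectType K) (br : {bilinear A -> A -> A}).
Variables (r : tensor A A) (r_anti : is_antisymmetric r).

Local Notation T := (rsharp r).
Local Notation dbr := (dual_bracket (delta_r br r)).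
Local Notation coadRB := (is_rel_rota_baxter br (dual_rep (Lmul br))
  (fun x => dual_rep (Lmul br) x - dual_rep (Rmul br) x) (rsharp r)).

Lemma rsharp_anti (a b : dual A) : b (T a) = - a (T b).
Proof.
rewrite !rsharpP -[X in - X]tpair_swap -linearN; congr (tpair _ _ _).
by apply/eqP; rewrite -addr_eq0; apply/eqP.
Qed.

Lemma dbr_deltaE (a b : dual A) x :
  dbr a b x = a (br x (T b) - br (T b) x) - b (br (T a) x).
Proof.
rewrite dual_bracketE delta_rE linearB /= tpair_mapl tpair_mapr -!rsharpP.
rewrite rsharp_anti !comp_lfunE RmulE; congr (_ - _).
by rewrite -linearN add_lfunE opp_lfunE LmulE RmulE opprB.
Qed.

(** [dbr a b] is the coadjoint expression to which [T] is applied on the right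
   of the Rota-Baxter identity, hence the multiplicativity of [T]. *)
Lemma coadRB_hom : coadRB <-> forall a b, br (T a) (T b) = T (dbr a b).
Proof.
have e (a b : dual A) : dual_rep (Lmul br) (T a) b +
    (dual_rep (Lmul br) (T b) - dual_rep (Rmul br) (T b)) a = dbr a b.
  apply/lfunP=> x; rewrite dbr_deltaE !(add_lfunE, opp_lfunE, dual_repE).
  by rewrite !LmulE RmulE linearB /=; ring.
by split=> h a b; rewrite h; congr (T _); rewrite -e.
Qed.

Lemma covec_br_sum n (f : dual A) (s t : 'I_n -> K) (u v : 'I_n -> A) :
  f (br (\sum_i s i *: u i) (\sum_j t j *: v j)) =
  \sum_i \sum_j s i * t j * f (br (u i) (v j)).
Proof.
rewrite linear_sumlz linear_sum; apply: eq_bigr => i _.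
rewrite linear_sumr linear_sum; apply: eq_bigr => j _.
by rewrite linearZl_LR linearZr_LR !linearZ /= -mulrA.
Qed.

(** The first term of [Al] pairs to [a [T b, T c]], the second one to
   [b ([T a, T c] - [T c, T a])] and the third one to [- c [T b, T a]]; the last
   two add up to the value of [dbr b c] at [T a], which is [- a (T (dbr b c))]
   since [T] is antisymmetric. *)
Lemma tpair3_Al (a b c : dual A) :
  tpair3 a b c (Al br r) = a (br (T b) (T c) - T (dbr b c)).
Proof.
have [n [u [v rE]]] := tensor_sum r.
have TE f : T f = \sum_i f (u i) *: v i by rewrite rE rsharp_sum.
have TNE f : T f = \sum_i f (v i) *: - u i.
  rewrite -rsharp_sum; congr (rsharp _ f).
  have /eqP := r_anti; rewrite addr_eq0 => /eqP ->.
  rewrite {1}rE (linear_sum (@tswap K A A)) -sumrN; apply: eq_bigr => i _ /=.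
  by rewrite tswapE linearNr.
(* Each [T f] is expanded on the left or on the right factors of [r],
   according to which factors carry the bracket in the given term of [Al]. *)
have E1 : a (br (T b) (T c)) =
    \sum_i \sum_j a (br (u i) (u j)) * b (v i) * c (v j).
  rewrite !TNE covec_br_sum; apply: eq_bigr => i _; apply: eq_bigr => j _.
  by rewrite linearNl linearNr opprK; ring.
have E2 : b (br (T a) (T c) - br (T c) (T a)) =
    \sum_i \sum_j a (u i) * b (br (u j) (v i) - br (v i) (u j)) * c (v j).
  rewrite (TE a) (TNE c) linearB /= !covec_br_sum.
  rewrite [X in _ - X]exchange_big -sumrB /=.
  apply: eq_bigr => i _; rewrite -sumrB; apply: eq_bigr => j _.
  by rewrite linearNl linearNr !(linearN, linearB) /=; ring.
have E3 : c (br (T b) (T a)) =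
    \sum_i \sum_j a (u i) * b (u j) * c (br (v j) (v i)).
  rewrite !TE covec_br_sum exchange_big.
  apply: eq_bigr => i _; apply: eq_bigr => j _.
  by rewrite (mulrC (a _)).
rewrite linearB /= (rsharp_anti (dbr b c)) opprK dbr_deltaE E1 E2 E3.
rewrite rE Al_sum linear_sum -sumrB -big_split; apply: eq_bigr => i _ /=.
rewrite linear_sum -sumrB -big_split; apply: eq_bigr => j _ /=.
by rewrite linearB linearD /= !tpair3E addrA.
Qed.

Lemma Al_eq0P : Al br r = 0 <-> coadRB.
Proof.
split=> [Al0 | /coadRB_hom h].
  apply/coadRB_hom => b c; apply/subr0_eq/covec_eq0 => a.
  by rewrite -tpair3_Al Al0 linear0.
by apply: tpair3_eq0 => a b c; rewrite tpair3_Al h subrr linear0.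
Qed.

Hypothesis brP : is_left_alia_algebra br.

(** Solved for one term, the left-Alia identity can be used for rewriting, after
   which the remaining identities between scalars are formal. *)
Lemma left_alia_covec (f : dual A) x y z :
  f (br (br x y) z) =
  f (br (br y x) z) + f (br (br z y) x) + f (br (br x z) y)
  - f (br (br y z) x) - f (br (br z x) y).
Proof. by rewrite -!linearD -brP !linearD /=; ring. Qed.

(** Multiplicativity of [T] turns the double brackets [dbr (dbr a b) c] into
   values of [a], [b], [c] on double brackets in [A]. *)
Lemma dual_left_alia : coadRB ->
  is_left_alia_algebra (dbr : {bilinear dual A -> dual A -> dual A}).
Proof.
move=> /coadRB_hom h a b c; apply/lfunP=> w.
rewrite !add_lfunE /= !(dbr_deltaE _ _ w) -!h.
rewrite !dbr_deltaE !(linearBl, linearBr).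
rewrite !(linearB a, linearB b, linearB c) /=.
rewrite (left_alia_covec a (T b) (T c)) (left_alia_covec b (T c) (T a)).
by rewrite (left_alia_covec c (T a) (T b)); ring.
Qed.

(** This is the symmetry in [a] and [b] by which the terms quadratic in the
   right multiplications cancel from the compatibility axiom. *)
Lemma rsharp_Rmul (a b : dual A) x y :
  b (br (T (a \o Rmul br x)%VF) y) = - a (br (T (b \o Rmul br y)%VF) x).
Proof.
by have := rsharp_anti (a \o Rmul br x) (b \o Rmul br y);
  rewrite !comp_lfunE !RmulE.
Qed.

Lemma delta_compat x y :
  let t := delta_r br r (br x y - br y x)
           + tmap (Rmul br x) id (delta_r br r y)
           - tmap (Rmul br y) id (delta_r br r x) in
  tswap t - t = 0.
Proof.
apply: tpair_eq0 => a b; rewrite linearB /= tpair_swap.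
rewrite !(linearB (tpair _ _), linearD (tpair _ _)) /=.
rewrite !tpair_mapl -!dual_bracketE.
rewrite !dbr_deltaE !comp_lfunE !RmulE.
rewrite !(linearBl, linearBr) !(linearB a, linearB b) /=.
rewrite !(rsharp_Rmul b a).
by rewrite (left_alia_covec a x y) (left_alia_covec b x y); ring.
Qed.

End YangBaxter.

Theorem corollary5p3 (K : closedFieldType) (pcharK0 : [pchar K] =i pred0)
    (A : vectType K) (br : {bilinear A -> A -> A})
    (brP : is_left_alia_algebra br)
    (r : tensor A A) (r_anti : is_antisymmetric r) :
  ((Al br r = 0 /\ is_triangular_left_alia_bialgebra br (delta_r br r))
   <->
   is_rel_rota_baxter br
     (dual_rep (Lmul br))
     (fun x => dual_rep (Lmul br) x - dual_rep (Rmul br) x)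
     (rsharp r))
  /\
  (is_rel_rota_baxter br
     (dual_rep (Lmul br))
     (fun x => dual_rep (Lmul br) x - dual_rep (Rmul br) x)
     (rsharp r) ->
   is_left_alia_hom (dual_bracket (delta_r br r)) br (rsharp r)).
Proof.
have AlP := Al_eq0P br r_anti.
split; last first.
  move=> h; split=> //; first exact: dual_left_alia.
  by move=> a b; symmetry; apply: (coadRB_hom br r_anti).1.
split=> [[Al0 _] | h]; first exact/AlP.
have Al0 := AlP.2 h; split=> //; split; last by exists r.
split=> //; last exact: delta_compat.
exact/left_alia_coalgebra_dual/dual_left_alia.
Qed.
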